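(* Let $\mathcal S=(\mathcal V,\mathcal C,\mathbb T,E)$ be a Monadic Equational System admitting free algebras, with $T$ the endofunctor underlying $\mathbb T$, and let $u,v:C\to TA$ be morphisms of $\mathcal C$. The following are equivalent. 1. Every $\mathcal S$-algebra satisfies $u\equiv v:C\to TA$. 2. The free $\mathcal S$-algebra $(T_{\mathcal S}A,\tau^{\mathcal S}_A)$ on $A$ satisfies $u\equiv v:C\to TA$. 3. $\mathsf q^{\mathcal S}_A\circ u=\mathsf q^{\mathcal S}_A\circ v:C\to T_{\mathcal S}A$.
   Context: An object written in place of a morphism denotes its identity. **Actions.** Let $\mathcal V=(\mathcal V,I,\cdot,\alpha,\lambda,\rho)$ be a monoidal category. A $\mathcal V$-action is a category $\mathcal C$ with a functor $*:\mathcal V\times\mathcal C\to\mathcal C$ and natural isomorphisms $\underline\lambda_C:I*C\to C$, $\underline\alpha_{U,V,C}:(U\cdot V)*C\to U*(V*C)$ with $\underline\lambda_{V*C}\circ\underline\alpha_{I,V,C}=\lambda_V*C$, $(V*\underline\lambda_C)\circ\underline\alpha_{V,I,C}=\rho_V*C$ and $(U*\underline\alpha_{V,W,C})\circ\underline\alpha_{U,V\cdot W,C}\circ(\alpha_{U,V,W}*C)=\underline\alpha_{U,V,W*C}\circ\underline\alpha_{U\cdot V,W,C}$. It is biclosed if every functor $(-)*C:\mathcal V\to\mathcal C$ has a right adjoint $\underline{\mathcal C}(C,-)$, with counit $\underline\varepsilon^C_D:\underline{\mathcal C}(C,D)*C\to D$, and every functor $V*(-):\mathcal C\to\mathcal C$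 has a right adjoint $[V,-]$. **Strong monads.** A strong monad $\mathbb T=(T,\varphi,\eta,\mu)$ on $\mathcal C$ is a monad $(T,\eta,\mu)$ on $\mathcal C$ with a natural transformation $\varphi_{V,C}:V*TC\to T(V*C)$ such that $T(\underline\lambda_C)\circ\varphi_{I,C}=\underline\lambda_{TC}$, $\varphi_{U,V*C}\circ(U*\varphi_{V,C})\circ\underline\alpha_{U,V,TC}=T(\underline\alpha_{U,V,C})\circ\varphi_{U\cdot V,C}$, $\varphi_{V,C}\circ(V*\eta_C)=\eta_{V*C}$ and $\varphi_{V,C}\circ(V*\mu_C)=\mu_{V*C}\circ T(\varphi_{V,C})\circ\varphi_{V,TC}$. **Satisfaction.** A $T$-equation $u\equiv v:C\to TA$ is a parallel pair of morphisms $u,v:C\to TA$ of $\mathcal C$. For a morphism $s:TX\to X$ and $t:C\to TA$ put $[\![t]\!]_{(X,s)}=s\circ T(\underline\varepsilon^A_X)\circ\varphi_{\underline{\mathcal C}(A,X),A}\circ(\underline{\mathcal C}(A,X)*t):\underline{\mathcal C}(A,X)*C\to X$. Then $(X,s)$ satisfies $u\equiv v:C\to TA$ iff $[\![u]\!]_{(X,s)}=[\![v]\!]_{(X,s)}$. **Monadic Equational Systems.** A Monadic Equational System (MES) $(\mathcal V,\mathcal C,\mathbb T,E)$ consists of a monoidal category $\mathcal V$, a biclosed $\mathcal V$-action $\mathcal C$, a strong monad $\mathbb T$ on $\mathcal C$, and a set $E$ of $T$-equations. An $\mathcal S$-algebra is an Eilenberg–Moore algebra $(X,s)$ for $\mathbb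 T$ satisfying every equation in $E$; $\mathcal S\text{-}\mathbf{Alg}$ is the full subcategory of the Eilenberg–Moore category $\mathcal C^{\mathbb T}$ on the $\mathcal S$-algebras. $\mathcal S$ admits free algebras if the forgetful functor $\mathcal S\text{-}\mathbf{Alg}\to\mathcal C$ has a left adjoint. In that case $(T_{\mathcal S}X,\tau^{\mathcal S}_X:TT_{\mathcal S}X\to T_{\mathcal S}X)$ denotes the free $\mathcal S$-algebra on $X\in\mathcal C$, and $\eta^{\mathcal S}_X:X\to T_{\mathcal S}X$ the unit of the adjunction. The quotient map $\mathsf q^{\mathcal S}_X:TX\to T_{\mathcal S}X$ is the unique morphism such that $\mathsf q^{\mathcal S}_X\circ\mu_X=\tau^{\mathcal S}_X\circ T(\mathsf q^{\mathcal S}_X)$ and $\mathsf q^{\mathcal S}_X\circ\eta_X=\eta^{\mathcal S}_X$. *)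

(* Defs.v *)
From Stdlib Require Import ssreflect ProofIrrelevance.

Set Implicit Arguments.
Unset Strict Implicit.
Unset Printing Implicit Defensive.

Declare Scope cat_scope.
Delimit Scope cat_scope with cat.
Open Scope cat_scope.

Reserved Notation "A ~> B" (at level 90, right associativity).
Reserved Notation "g ∘ f" (at level 40, left associativity).

Record category := Category {
  ob :> Type;
  hom : ob -> ob -> Type where "A ~> B" := (hom A B);
  idm : forall A, A ~> A;
  comp : forall A B C, (B ~> C) -> (A ~> B) -> (A ~> C)
    where "g ∘ f" := (comp g f);
  comp_idl : forall A B (f : A ~> B), idm B ∘ f = f;
  comp_idr : forall A B (f : A ~> B), f ∘ idm A = f;
  comp_assoc : forall A B C D (h : C ~> D) (g : B ~> C) (f : A ~> B),
    h ∘ (g ∘ f) = (h ∘ g) ∘ f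
}.

Notation "A ~> B" := (hom A B) : cat_scope.
Notation "g ∘ f" := (comp g f) : cat_scope.
Arguments idm {_} A.

Definition is_iso (C : category) (A B : C) (f : A ~> B) : Prop :=
  exists g : B ~> A, g ∘ f = idm A /\ f ∘ g = idm B.

Record functor (C D : category) := Functor {
  fob :> C -> D;
  fmap : forall A B : C, (A ~> B) -> (fob A ~> fob B);
  fmap_id : forall A : C, fmap (idm A) = idm (fob A);
  fmap_comp : forall (A B X : C) (g : B ~> X) (f : A ~> B),
    fmap (g ∘ f) = fmap g ∘ fmap f
}.

Arguments fmap {C D} _ {A B} _.

Definition compF (C D E : category) (G : functor D E) (F : functor C D) :
  functor C E.
Proof.
refine (@Functor C E (fun A => G (F A)) (fun A B f => fmap G (fmap F f)) _ _).
- by move=> A; rewrite !fmap_id.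
- by move=> A B X g f; rewrite !fmap_comp.
Defined.

Definition prodC (C D : category) : category.
Proof.
refine (@Category (C * D)
  (fun A B => ((fst A ~> fst B) * (snd A ~> snd B))%type)
  (fun A => (idm (fst A), idm (snd A)))
  (fun A B X g f => (fst g ∘ fst f, snd g ∘ snd f)) _ _ _).
- by move=> A B [f1 f2] /=; rewrite !comp_idl.
- by move=> A B [f1 f2] /=; rewrite !comp_idr.
- by move=> A B X Y h g f /=; rewrite !comp_assoc.
Defined.

Section Bifunctor.
Context {C D E : category} (F : functor (prodC C D) E).

Definition bimap (A A' : C) (B B' : D) (f : A ~> A') (g : B ~> B') :
    F (A, B) ~> F (A', B') :=
  @fmap _ _ F (A, B) (A', B') (f, g).

Lemma bimap_comp (A A' A'' : C) (B B' B'' : D)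
    (f' : A' ~> A'') (f : A ~> A') (g' : B' ~> B'') (g : B ~> B') :
  bimap (f' ∘ f) (g' ∘ g) = bimap f' g' ∘ bimap f g.
Proof. by rewrite /bimap -fmap_comp. Qed.

(* [fix_left A] is F(A, -) and [fix_right B] is F(-, B). *)
Definition fix_left (A : C) : functor D E.
Proof.
refine (@Functor D E (fun B => F (A, B)) (fun B B' g => bimap (idm A) g) _ _).
- by move=> B; exact: (fmap_id F (A, B)).
- by move=> B B' B'' g f; rewrite -bimap_comp comp_idl.
Defined.

Definition fix_right (B : D) : functor C E.
Proof.
refine (@Functor C E (fun A => F (A, B)) (fun A A' f => bimap f (idm B)) _ _).
- by move=> A; exact: (fmap_id F (A, B)).
- by move=> A A' A'' g f; rewrite -bimap_comp comp_idl.
Defined.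
End Bifunctor.

(* F is left adjoint to G. *)
Record adjunction (C D : category) (F : functor C D) (G : functor D C) :=
  Adjunction {
  unit : forall A : C, A ~> G (F A);
  counit : forall B : D, F (G B) ~> B;
  unit_natural : forall (A A' : C) (f : A ~> A'),
    unit A' ∘ f = fmap G (fmap F f) ∘ unit A;
  counit_natural : forall (B B' : D) (g : B ~> B'),
    counit B' ∘ fmap F (fmap G g) = g ∘ counit B;
  triangle_left : forall A : C, counit (F A) ∘ fmap F (unit A) = idm (F A);
  triangle_right : forall B : D, fmap G (counit B) ∘ unit (G B) = idm (G B)
}.

Record right_adjoint (C D : category) (F : functor C D) := RightAdjoint {
  radj :> functor D C;
  radj_adjunction : adjunction F radj
}.

Record left_adjoint (C D : category) (G : functor D C) := LeftAdjoint {
  ladj :> functor C D;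
  ladj_adjunction : adjunction ladj G
}.

Reserved Notation "U ⋅ V" (at level 35, right associativity).

Record monoidal_category := MonoidalCategory {
  mcat :> category;
  tensor : functor (prodC mcat mcat) mcat
    where "U ⋅ V" := (tensor (U, V));
  munit : mcat;
  massoc : forall U V W : mcat, (U ⋅ V) ⋅ W ~> U ⋅ (V ⋅ W);
  mlunit : forall V : mcat, munit ⋅ V ~> V;
  mrunit : forall V : mcat, V ⋅ munit ~> V;
  massoc_natural : forall (U U' V V' W W' : mcat)
      (f : U ~> U') (g : V ~> V') (h : W ~> W'),
    massoc U' V' W' ∘ bimap tensor (bimap tensor f g) h
    = bimap tensor f (bimap tensor g h) ∘ massoc U V W;
  mlunit_natural : forall (V V' : mcat) (f : V ~> V'),
    mlunit V' ∘ bimap tensor (idm munit) f = f ∘ mlunit V;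
  mrunit_natural : forall (V V' : mcat) (f : V ~> V'),
    mrunit V' ∘ bimap tensor f (idm munit) = f ∘ mrunit V;
  massoc_iso : forall U V W : mcat, is_iso (massoc U V W);
  mlunit_iso : forall V : mcat, is_iso (mlunit V);
  mrunit_iso : forall V : mcat, is_iso (mrunit V);
  mtriangle : forall U V : mcat,
    bimap tensor (idm U) (mlunit V) ∘ massoc U munit V
    = bimap tensor (mrunit U) (idm V);
  mpentagon : forall U V W X : mcat,
    bimap tensor (idm U) (massoc V W X) ∘ massoc U (V ⋅ W) X
      ∘ bimap tensor (massoc U V W) (idm X)
    = massoc U V (W ⋅ X) ∘ massoc (U ⋅ V) W X
}.

Notation "U ⋅ V" := (tensor _ (U, V)) : cat_scope.
Arguments munit {_}.
Arguments massoc {_} U V W.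
Arguments mlunit {_} V.
Arguments mrunit {_} V.

Reserved Notation "V ∗ X" (at level 35, right associativity).

Record action (V : monoidal_category) (C : category) := Action {
  act :> functor (prodC V C) C where "U ∗ X" := (act (U, X));
  alunit : forall X : C, munit ∗ X ~> X;
  aassoc : forall (U W : V) (X : C), (U ⋅ W) ∗ X ~> U ∗ (W ∗ X);
  alunit_natural : forall (X X' : C) (f : X ~> X'),
    alunit X' ∘ bimap act (idm munit) f = f ∘ alunit X;
  aassoc_natural : forall (U U' W W' : V) (X X' : C)
      (f : U ~> U') (g : W ~> W') (h : X ~> X'),
    aassoc U' W' X' ∘ bimap act (bimap (tensor V) f g) h
    = bimap act f (bimap act g h) ∘ aassoc U W X;
  alunit_iso : forall X : C, is_iso (alunit X);
  aassoc_iso : forall (U W : V) (X : C), is_iso (aassoc U W X);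
  alunit_left : forall (W : V) (X : C),
    alunit (W ∗ X) ∘ aassoc munit W X = bimap act (mlunit W) (idm X);
  alunit_right : forall (W : V) (X : C),
    bimap act (idm W) (alunit X) ∘ aassoc W munit X
    = bimap act (mrunit W) (idm X);
  apentagon : forall (U W Z : V) (X : C),
    bimap act (idm U) (aassoc W Z X) ∘ aassoc U (W ⋅ Z) X
      ∘ bimap act (massoc U W Z) (idm X)
    = aassoc U W (Z ∗ X) ∘ aassoc (U ⋅ W) Z X
}.

Arguments alunit {V C} _ X.
Arguments aassoc {V C} _ U W X.

Record biclosed_action (V : monoidal_category) (C : category) :=
  BiclosedAction {
  baction :> action V C;
  inner_hom : forall X : C, right_adjoint (fix_right baction X);
  cotensor : forall W : V, right_adjoint (fix_left baction W)
}.

Definition ev (V : monoidal_category) (C : category) (a : biclosed_action V C)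
    (X Y : C) : a (inner_hom a X Y, X) ~> Y :=
  counit (radj_adjunction (inner_hom a X)) Y.

Record monad (C : category) := Monad {
  mfun :> functor C C;
  meta : forall X : C, X ~> mfun X;
  mmu : forall X : C, mfun (mfun X) ~> mfun X;
  meta_natural : forall (X Y : C) (f : X ~> Y),
    meta Y ∘ f = fmap mfun f ∘ meta X;
  mmu_natural : forall (X Y : C) (f : X ~> Y),
    mmu Y ∘ fmap mfun (fmap mfun f) = fmap mfun f ∘ mmu X;
  mmu_etal : forall X : C, mmu X ∘ meta (mfun X) = idm (mfun X);
  mmu_etar : forall X : C, mmu X ∘ fmap mfun (meta X) = idm (mfun X);
  mmu_assoc : forall X : C, mmu X ∘ mmu (mfun X) = mmu X ∘ fmap mfun (mmu X)
}.

Arguments meta {C} _ X.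
Arguments mmu {C} _ X.

Record strong_monad (V : monoidal_category) (C : category) (a : action V C) :=
  StrongMonad {
  smonad :> monad C;
  strength : forall (W : V) (X : C), a (W, smonad X) ~> smonad (a (W, X));
  strength_natural : forall (W W' : V) (X X' : C) (f : W ~> W') (g : X ~> X'),
    strength W' X' ∘ bimap a f (fmap smonad g)
    = fmap smonad (bimap a f g) ∘ strength W X;
  strength_unit : forall X : C,
    fmap smonad (alunit a X) ∘ strength munit X = alunit a (smonad X);
  strength_assoc : forall (U W : V) (X : C),
    strength U (a (W, X)) ∘ bimap a (idm U) (strength W X)
      ∘ aassoc a U W (smonad X)
    = fmap smonad (aassoc a U W X) ∘ strength (U ⋅ W) X;
  strength_eta : forall (W : V) (X : C),
    strength W X ∘ bimap a (idm W) (meta smonad X) = meta smonad (a (W, X));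
  strength_mu : forall (W : V) (X : C),
    strength W X ∘ bimap a (idm W) (mmu smonad X)
    = mmu smonad (a (W, X)) ∘ fmap smonad (strength W X)
      ∘ strength W (smonad X)
}.

Arguments strength {V C a} _ W X.

Section EilenbergMoore.
Context {C : category} (T : monad C).

Record em_algebra := EMAlgebra {
  carrier : C;
  structure : T carrier ~> carrier;
  structure_eta : structure ∘ meta T carrier = idm carrier;
  structure_mu : structure ∘ mmu T carrier = structure ∘ fmap T structure
}.

Record em_hom (A B : em_algebra) := EMHom {
  em_map : carrier A ~> carrier B;
  em_map_structure : em_map ∘ structure A = structure B ∘ fmap T em_map
}.

Lemma em_hom_eq (A B : em_algebra) (f g : em_hom A B) :
  em_map f = em_map g -> f = g.
Proof.
case: f g => [f fP] [g gP] /= fg; case: _ / fg in gP *.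
by rewrite (proof_irrelevance _ fP gP).
Qed.

Definition em_id (A : em_algebra) : em_hom A A.
Proof.
by refine (@EMHom A A (idm _) _); rewrite fmap_id comp_idl comp_idr.
Defined.

Definition em_comp (A B X : em_algebra) (g : em_hom B X) (f : em_hom A B) :
  em_hom A X.
Proof.
refine (@EMHom A X (em_map g ∘ em_map f) _).
by rewrite fmap_comp -comp_assoc em_map_structure comp_assoc
  em_map_structure -comp_assoc.
Defined.

Definition em_category : category.
Proof.
refine (@Category em_algebra em_hom em_id em_comp _ _ _).
- by move=> A B f; apply: em_hom_eq; exact: comp_idl.
- by move=> A B f; apply: em_hom_eq; exact: comp_idr.
- by move=> A B X Y h g f; apply: em_hom_eq; exact: comp_assoc.
Defined.

Definition em_forget : functor em_category C :=
  @Functor em_category C carrier em_map (fun _ => eq_refl)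
    (fun _ _ _ _ _ => eq_refl).
End EilenbergMoore.

Definition full_subcategory (C : category) (P : C -> Prop) : category :=
  @Category {X : C | P X} (fun X Y => proj1_sig X ~> proj1_sig Y)
    (fun X => idm (proj1_sig X)) (fun X Y Z g f => g ∘ f)
    (fun X Y f => comp_idl f) (fun X Y f => comp_idr f)
    (fun X Y Z W h g f => comp_assoc h g f).

Definition full_inclusion (C : category) (P : C -> Prop) :
    functor (full_subcategory P) C :=
  @Functor (full_subcategory P) C (@proj1_sig C P) (fun X Y f => f)
    (fun _ => eq_refl) (fun _ _ _ _ _ => eq_refl).

Section Satisfaction.
Context {V : monoidal_category} {C : category} {a : biclosed_action V C}
  (T : strong_monad a).

Definition interp (X : C) (s : T X ~> X) (K A : C) (t : K ~> T A) :
    a (inner_hom a A X, K) ~> X :=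
  s ∘ fmap T (ev a A X) ∘ strength T (inner_hom a A X) A
    ∘ bimap a (idm (inner_hom a A X)) t.

Definition satisfies (X : C) (s : T X ~> X) (K A : C) (u v : K ~> T A) : Prop :=
  interp s u = interp s v.

Record equation := Equation {
  eq_dom : C;
  eq_arity : C;
  eq_lhs : eq_dom ~> T eq_arity;
  eq_rhs : eq_dom ~> T eq_arity
}.
End Satisfaction.

Record MES := MonadicEquationalSystem {
  mes_base : monoidal_category;
  mes_cat : category;
  mes_action : biclosed_action mes_base mes_cat;
  mes_monad : strong_monad mes_action;
  mes_equations : equation mes_monad -> Prop
}.

Section Algebras.
Context (S : MES).
Let T := mes_monad S.

Definition is_mes_algebra (X : em_category T) : Prop :=
  forall e : equation T, mes_equations e ->
    satisfies (structure X) (eq_lhs e) (eq_rhs e).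

Definition mes_alg : category := full_subcategory is_mes_algebra.

Definition mes_forget : functor mes_alg (mes_cat S) :=
  compF (em_forget T) (full_inclusion is_mes_algebra).

Definition alg_carrier (X : mes_alg) : mes_cat S := carrier (proj1_sig X).

Definition alg_structure (X : mes_alg) : T (alg_carrier X) ~> alg_carrier X :=
  structure (proj1_sig X).

Definition alg_satisfies (X : mes_alg) (K A : mes_cat S) (u v : K ~> T A) :
    Prop :=
  satisfies (alg_structure X) u v.

Definition free_algebras : Type := left_adjoint mes_forget.

Context (L : free_algebras).

Definition free_carrier (X : mes_cat S) : mes_cat S := alg_carrier (L X).

Definition free_structure (X : mes_cat S) :
    T (free_carrier X) ~> free_carrier X :=
  alg_structure (L X).

Definition free_unit (X : mes_cat S) : X ~> free_carrier X :=
  unit (ladj_adjunction L) X.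

Definition is_quotient_map (X : mes_cat S) (q : T X ~> free_carrier X) : Prop :=
  q ∘ mmu T X = free_structure X ∘ fmap T q /\ q ∘ meta T X = free_unit X.

Definition quotient_map_sig (X : mes_cat S) :
  {q : T X ~> free_carrier X | unique (is_quotient_map (X := X)) q}.
Proof.
exists (free_structure X ∘ fmap T (free_unit X)); split; [split|].
- rewrite -comp_assoc -mmu_natural comp_assoc.
  rewrite /free_structure /alg_structure structure_mu.
  by rewrite [in RHS]fmap_comp comp_assoc.
- rewrite -comp_assoc -meta_natural comp_assoc.
  by rewrite /free_structure /alg_structure structure_eta comp_idl.
- move=> q [qmu qeta].
  by rewrite -qeta fmap_comp comp_assoc -qmu -comp_assoc mmu_etar comp_idr.
Defined.

Definition quotient_map (X : mes_cat S) : T X ~> free_carrier X :=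
  proj1_sig (quotient_map_sig X).
End Algebras.

(* Main.v *)
(* Satisfaction of [u ≡ v] by an algebra can be tested against arbitrary maps
   [g : W ∗ A ~> X] instead of the universal one [ev], since every such [g]
   factors through [ev].  Testing the free algebra against
   [free_unit A ∘ alunit A] gives equality after composing with the quotient
   map.  Conversely, for an algebra [X] the cotensor [[W, X]] is again an
   algebra, so the transpose of [ev : W ∗ A ~> X], with [W] the inner hom from
   [A] to [X], extends along the free unit to a homomorphism from the free
   algebra on [A]; hence the interpretation of a term in [X] factors through
   the composite of the term with the quotient map. *)

From Stdlib Require Import ssreflect.
Require Import Defs.

Set Implicit Arguments.
Unset Strict Implicit.
Unset Printing Implicit Defensive.

Lemma iso_cancel_right (C : category) (A B D : C) (i : A ~> B) (f g : B ~> D) :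
  is_iso i -> f ∘ i = g ∘ i -> f = g.
Proof.
move=> [j [_ ij]] fg.
by rewrite -(comp_idr f) -(comp_idr g) -ij !comp_assoc fg.
Qed.

Section Transpose.
Context {C D : category} {F : functor C D} {G : functor D C}
  (adj : adjunction F G).

Definition transpose (A : C) (B : D) (f : F A ~> B) : A ~> G B :=
  fmap G f ∘ unit adj A.

Lemma counit_transpose (A : C) (B : D) (f : F A ~> B) :
  counit adj B ∘ fmap F (transpose f) = f.
Proof.
by rewrite /transpose fmap_comp comp_assoc counit_natural -comp_assoc
  triangle_left comp_idr.
Qed.

Lemma transpose_counit (A : C) (B : D) (f : A ~> G B) :
  transpose (counit adj B ∘ fmap F f) = f.
Proof.
by rewrite /transpose fmap_comp -comp_assoc -unit_natural comp_assoc
  triangle_right comp_idl.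
Qed.

Lemma counit_inj (A : C) (B : D) (f g : A ~> G B) :
  counit adj B ∘ fmap F f = counit adj B ∘ fmap F g -> f = g.
Proof. by move=> fg; rewrite -(transpose_counit f) fg transpose_counit. Qed.
End Transpose.

Section Bimap.
Context {C D E : category} (F : functor (prodC C D) E).

Lemma bimap_id (A : C) (B : D) : bimap F (idm A) (idm B) = idm (F (A, B)).
Proof. exact: (fmap_id F (A, B)). Qed.

Lemma bimap_compr (A : C) (B B' B'' : D) (g : B' ~> B'') (f : B ~> B') :
  bimap F (idm A) (g ∘ f) = bimap F (idm A) g ∘ bimap F (idm A) f.
Proof. by rewrite -bimap_comp comp_idl. Qed.

Lemma bimap_exchange (A A' : C) (B B' : D) (f : A ~> A') (g : B ~> B') :
  bimap F (idm A') g ∘ bimap F f (idm B)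
  = bimap F f (idm B') ∘ bimap F (idm A) g.
Proof. by rewrite -!bimap_comp !comp_idl !comp_idr. Qed.
End Bimap.

Section Interpretation.
Context {V : monoidal_category} {C : category} {a : biclosed_action V C}
  (T : strong_monad a).

(** At [g := ev a A X] this is [interp] by conversion. *)
Definition interp_along (X : C) (s : T X ~> X) (W : V) (K A : C)
    (g : a (W, A) ~> X) (t : K ~> T A) : a (W, K) ~> X :=
  s ∘ fmap T g ∘ strength T W A ∘ bimap a (idm W) t.

Lemma strength_natural_left (W W' : V) (X : C) (f : W ~> W') :
  strength T W' X ∘ bimap a f (idm (T X))
  = fmap T (bimap a f (idm X)) ∘ strength T W X.
Proof. by rewrite -strength_natural fmap_id. Qed.

(** The transpose of [g] acts only on the parameter object, so naturality of the strength in that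
    argument moves it past [t] to the far right. *)
Lemma interp_along_factor (X : C) (s : T X ~> X) (W : V) (K A : C)
    (g : a (W, A) ~> X) (t : K ~> T A) :
  interp_along s g t
  = interp s t
    ∘ bimap a (transpose (radj_adjunction (inner_hom a A)) (g : fix_right a A W ~> X)) (idm K).
Proof.
set h := transpose _ _.
have gE : ev a A X ∘ bimap a h (idm A) = g
  by exact: (counit_transpose (radj_adjunction (inner_hom a A))).
rewrite /interp /interp_along -!comp_assoc bimap_exchange.
rewrite (comp_assoc (strength T _ _)) strength_natural_left -gE fmap_comp.
by rewrite !comp_assoc.
Qed.

Lemma satisfies_interp_along (X : C) (s : T X ~> X) (K A : C)
    (u v : K ~> T A) :
  satisfies s u v
  <-> forall (W : V) (g : a (W, A) ~> X),
        interp_along s g u = interp_along s g v.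
Proof.
split=> [uv W g | uv]; last exact: uv.
by rewrite !interp_along_factor uv.
Qed.

(** With the unit object as parameter, [strength_unit] absorbs the strength. What remains is the
    ordinary extension of [f] along [T], up to an isomorphism that can be cancelled. *)
Lemma interp_along_unit (X A : C) (s : T X ~> X) (f : A ~> X) (K : C)
    (t : K ~> T A) :
  interp_along s (f ∘ alunit a A) t = s ∘ fmap T f ∘ t ∘ alunit a K.
Proof.
rewrite /interp_along fmap_comp -!comp_assoc.
by rewrite (comp_assoc (fmap T (alunit a A))) strength_unit alunit_natural.
Qed.
End Interpretation.

Section Cotensor.
Context {V : monoidal_category} {C : category} {a : biclosed_action V C}
  (T : strong_monad a) (W : V).

Definition coev (X : C) : a (W, cotensor a W X) ~> X :=
  counit (radj_adjunction (cotensor a W)) X.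

Definition cocurry (X Y : C) (f : a (W, Y) ~> X) : Y ~> cotensor a W X :=
  transpose (radj_adjunction (cotensor a W)) (f : fix_left a W Y ~> X).

Lemma coev_cocurry (X Y : C) (f : a (W, Y) ~> X) :
  coev X ∘ bimap a (idm W) (cocurry f) = f.
Proof. exact: (counit_transpose (radj_adjunction (cotensor a W))). Qed.

Lemma coev_inj (X Y : C) (f g : Y ~> cotensor a W X) :
  coev X ∘ bimap a (idm W) f = coev X ∘ bimap a (idm W) g -> f = g.
Proof. exact: (counit_inj (adj := radj_adjunction (cotensor a W))). Qed.

(** The strength lifts the right adjoint of [W ∗ -] to algebras. *)
Definition cotensor_structure (X : C) (s : T X ~> X) :
    T (cotensor a W X) ~> cotensor a W X :=
  cocurry (s ∘ fmap T (coev X) ∘ strength T W (cotensor a W X)).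

Lemma coev_cotensor_structure (X Y : C) (s : T X ~> X)
    (f : Y ~> cotensor a W X) :
  coev X ∘ bimap a (idm W) (cotensor_structure s ∘ fmap T f)
  = s ∘ fmap T (coev X ∘ bimap a (idm W) f) ∘ strength T W Y.
Proof.
rewrite bimap_compr comp_assoc coev_cocurry fmap_comp -!comp_assoc.
by rewrite strength_natural.
Qed.

Lemma cotensor_structure_eta (X : em_algebra T) :
  cotensor_structure (structure X) ∘ meta T _ = idm _.
Proof.
(* After transposing back, [strength_eta] reduces the claim to the unit law of [X]. *)
apply: coev_inj; rewrite bimap_compr comp_assoc coev_cocurry -comp_assoc.
rewrite strength_eta -comp_assoc -meta_natural comp_assoc structure_eta.
by rewrite comp_idl bimap_id comp_idr.
Qed.

Lemma cotensor_structure_mu (X : em_algebra T) :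
  cotensor_structure (structure X) ∘ mmu T _
  = cotensor_structure (structure X)
    ∘ fmap T (cotensor_structure (structure X)).
Proof.
apply: coev_inj; rewrite coev_cotensor_structure coev_cocurry.
rewrite bimap_compr comp_assoc coev_cocurry -comp_assoc strength_mu.
rewrite !comp_assoc -(comp_assoc _ (fmap T (coev _))) -mmu_natural.
by rewrite comp_assoc structure_mu !fmap_comp !comp_assoc.
Qed.

Definition cotensor_algebra (X : em_algebra T) : em_algebra T :=
  EMAlgebra (cotensor_structure_eta X) (cotensor_structure_mu X).

(** Two successive strengths, for [U] and then [W], merge into one for [W ⋅ U] by
    [strength_assoc]. *)
Lemma interp_along_cotensor (X : C) (s : T X ~> X) (U : V) (K A : C)
    (g : a (U, A) ~> cotensor a W X) (t : K ~> T A) :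
  coev X ∘ bimap a (idm W) (interp_along (cotensor_structure s) g t)
    ∘ aassoc a W U K
  = interp_along s (coev X ∘ bimap a (idm W) g ∘ aassoc a W U A) t.
Proof.
rewrite /interp_along -(comp_assoc (cotensor_structure s ∘ _)) bimap_compr.
rewrite (comp_assoc (coev X)) coev_cotensor_structure bimap_compr.
rewrite -!comp_assoc -aassoc_natural bimap_id.
rewrite (comp_assoc (bimap a (idm W) (strength _ _ _))).
rewrite (comp_assoc (strength T W _)) (comp_assoc (strength T W _)).
by rewrite strength_assoc !fmap_comp !comp_assoc.
Qed.

Lemma satisfies_cotensor (X : C) (s : T X ~> X) (K A : C) (u v : K ~> T A) :
  satisfies s u v -> satisfies (cotensor_structure s) u v.
Proof.
move/satisfies_interp_along => uv; apply/satisfies_interp_along => U g.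
(* Transposition is injective and the associator invertible, so it suffices to compare
   interpretations in [X] with parameter [W ⋅ U]. *)
apply: coev_inj; apply: (iso_cancel_right (aassoc_iso a W U K)).
by rewrite !interp_along_cotensor.
Qed.
End Cotensor.

Section FreeAlgebra.
Context (S : MES) (L : free_algebras S).
Let T := mes_monad S.

Lemma free_algebra_extension (X : em_category T) (A : mes_cat S)
    (f : A ~> carrier X) :
  is_mes_algebra X ->
  exists h : free_carrier L A ~> carrier X,
    structure X ∘ fmap T f = h ∘ quotient_map L A.
Proof.
move=> Xalg; pose Y : mes_alg S := exist _ X Xalg.
pose h : em_hom (proj1_sig (L A)) X :=
  counit (ladj_adjunction L) Y
    ∘ fmap L (f : A ~> mes_forget S Y).
exists (em_map h).
have <- : em_map h ∘ free_unit L A = f.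
  rewrite /h /free_unit /= -comp_assoc.
  have /= <- := unit_natural (ladj_adjunction L) (f : A ~> mes_forget S Y).
  rewrite comp_assoc.
  have /= -> := triangle_right (ladj_adjunction L) Y.
  by rewrite comp_idl.
(* [quotient_map] unfolds to [free_structure ∘ fmap T free_unit], and [h] commutes with the
   structures. *)
by rewrite fmap_comp comp_assoc -em_map_structure -comp_assoc.
Qed.

Lemma quotient_map_satisfies (X : mes_alg S) (K A : mes_cat S)
    (u v : K ~> T A) :
  quotient_map L A ∘ u = quotient_map L A ∘ v -> alg_satisfies X u v.
Proof.
move=> quv; apply/satisfies_interp_along => W g.
have Walg : is_mes_algebra (cotensor_algebra W (proj1_sig X))
  by move=> e eE; apply/satisfies_cotensor/(proj2_sig X).
have [h hq] := free_algebra_extension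
  (X := cotensor_algebra W (proj1_sig X)) (cocurry g) Walg.
(* The same [h] serves every term [t], as it depends only on [g]. *)
have interpE t : interp_along (alg_structure X) g t
    = coev W _ ∘ bimap _ (idm W) (h ∘ (quotient_map L A ∘ t)).
  rewrite comp_assoc -hq bimap_compr comp_assoc coev_cotensor_structure.
  by rewrite coev_cocurry.
by rewrite !interpE quv.
Qed.

Lemma free_satisfies_quotient_map (K A : mes_cat S) (u v : K ~> T A) :
  alg_satisfies (L A) u v -> quotient_map L A ∘ u = quotient_map L A ∘ v.
Proof.
(* By [interp_along_unit], this test map yields the quotient map in its unfolded form. *)
move/satisfies_interp_along=> /(_ _ (free_unit L A ∘ alunit _ A)).
rewrite !interp_along_unit.
exact: (iso_cancel_right (alunit_iso (mes_action S) K)).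
Qed.
End FreeAlgebra.

Theorem theorem8p6 (S : MES) (L : free_algebras S)
    (C A : mes_cat S) (u v : C ~> mes_monad S A) :
  ((forall X : mes_alg S, alg_satisfies X u v)
     <-> alg_satisfies (L A) u v)
  /\ (alg_satisfies (L A) u v
     <-> quotient_map L A ∘ u = quotient_map L A ∘ v).
Proof.
split; split=> [uv | uv].
- exact: uv.
- move=> X; apply: (quotient_map_satisfies (L := L)).
  exact: free_satisfies_quotient_map.
- exact: free_satisfies_quotient_map.
- exact: quotient_map_satisfies uv.
Qed.
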